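(* For any $n\ge1$, $$\sum_{\pi\in\mathfrak{S}_n(321)}t^{\mathsf{wex}\,\pi}q^{\mathsf{inv}\,\pi}=\sum_{k=1}^{\lfloor (n+1)/2\rfloor}\Big(q^{n-k}\sum_{\pi\in\widetilde{\mathfrak{S}}_{n,k-1}(231)}q^{(13\text{-}2)\pi}\Big)t^k(1+t/q)^{n+1-2k}.$$
   Context: $\mathfrak{S}_n(\tau)$: permutations of $[n]$ avoiding classical pattern $\tau$. $\mathsf{wex}\,\pi=\#\{i:\pi(i)\ge i\}$, $\mathsf{inv}\,\pi=\#\{i<j:\pi(i)>\pi(j)\}$, $\mathsf{des}\,\pi=\#\{i\in[n-1]:\pi(i)>\pi(i+1)\}$, $(13\text{-}2)\pi=\#\{(i,j):i+1<j\le n,\pi(i)<\pi(j)<\pi(i+1)\}$. $\mathsf{dd}^*\,\pi$ is the number of $i\in[n]$ with $\pi(i-1)>\pi(i)>\pi(i+1)$ under boundary $\pi(0)=\pi(n+1)=n+1$. $\widetilde{\mathfrak{S}}_{n,k}(231)=\{\pi\in\mathfrak{S}_n(231):\mathsf{dd}^*\,\pi=0,\ \mathsf{des}\,\pi=k\}$. *)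

(* Defs.v *)
(* Permutations of [n] are elements of 'S_n = {perm 'I_n};
   position i (0-based) carries value val (s i) (0-based); the 1-based
   permutation is pi(i+1) = val (s i) + 1. *)
From HB Require Import structures.
From mathcomp Require Import all_boot all_order all_algebra all_fingroup.
Set Implicit Arguments. Unset Strict Implicit. Unset Printing Implicit Defensive.
Import Order.TTheory GRing.Theory Num.Theory.

Definition pword n (s : 'S_n) : seq nat := [seq val (s i) | i <- enum 'I_n].

Definition order_iso (u v : seq nat) : bool :=
  (size u == size v) &&
  [forall i : 'I_(size u), forall j : 'I_(size u),
     (nth 0 u i < nth 0 u j) == (nth 0 v i < nth 0 v j)].

Definition contains n (s : 'S_n) (tau : seq nat) : bool :=
  [exists m : n.-tuple bool, order_iso (mask m (pword s)) tau].

Definition avoids n (s : 'S_n) (tau : seq nat) : bool := ~~ contains s tau.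

Definition wex n (s : 'S_n) : nat := #|[set i : 'I_n | i <= s i]|.

Definition invst n (s : 'S_n) : nat :=
  #|[set p : 'I_n * 'I_n | (p.1 < p.2) && (s p.2 < s p.1)]|.

Definition des n (s : 'S_n) : nat :=
  let w := pword s in
  count (fun i => nth 0 w i.+1 < nth 0 w i) (iota 0 n.-1).

Definition st132 n (s : 'S_n) : nat :=
  let w := pword s in
  #|[set p : 'I_n * 'I_n | (p.1.+1 < p.2) &&
       (nth 0 w p.1 < nth 0 w p.2 < nth 0 w p.1.+1)]|.

(* dd* pi with boundary pi(0) = pi(n+1) = n+1 (1-based values) *)
Definition ddstar n (s : 'S_n) : nat :=
  let e := n.+1 :: rcons [seq x.+1 | x <- pword s] n.+1 in
  count (fun i => (nth 0 e i.+1 < nth 0 e i) && (nth 0 e i.+2 < nth 0 e i.+1))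
        (iota 0 n).

Definition tildeS231 n (k : nat) (s : 'S_n) : bool :=
  [&& avoids s [:: 2; 3; 1]%N, ddstar s == 0 & des s == k].

(* Main.v *)
Require Import Defs.
From HB Require Import structures.
From mathcomp Require Import all_boot all_order all_algebra all_fingroup.
From mathcomp Require Import zify ring.
Import Order.TTheory GRing.Theory Num.Theory.
Local Open Scope ring_scope.
Set Implicit Arguments.
Unset Strict Implicit.
Unset Printing Implicit Defensive.

(** Both sides are computed by building permutations one last letter at a time.

    A 321-avoiding word of length n is extended by the letters above its largest
    inversion bottom; if e + 1 is the number of letters above that bottom, then
    appending the maximum (weight t) leads to e + 1, and appending a letter
    exceeded by i + 1 others (weight q^(i+1)) leads to i, for i = 0, ..., e.
    For a 231-avoiding word without double descents, the letters allowed are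
    those above the largest ascent bottom, appending a letter exceeded by c
    others creates exactly c new occurrences of 13-2, and it is a descent iff
    c takes its maximal value.

    The transfer operator of the first tree is tridiagonal in the basis of
    q-binomial coefficients [e choose h], which makes its powers weighted counts
    of Motzkin paths; the generating functions of the second tree satisfy the
    same three-term recurrence, after rescaling by (t/q)^h q^n. *)

(** * Gaussian binomial coefficients and the transfer operator of the first tree *)

Fixpoint qbin (R : comNzRingType) (q : R) (n h : nat) : R :=
  match n, h with
  | _, 0 => 1
  | 0, _.+1 => 0
  | n'.+1, h'.+1 => q ^+ h'.+1 * qbin q n' h'.+1 + qbin q n' h'
  end.

Lemma qbinn0 (R : comNzRingType) (q : R) (n : nat) : qbin q n 0 = 1.
Proof. by case: n. Qed.

Lemma qbin0S (R : comNzRingType) (q : R) (h : nat) : qbin q 0 h.+1 = 0.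
Proof. by []. Qed.

Lemma qbinS (R : comNzRingType) (q : R) (n h : nat) :
  qbin q n.+1 h.+1 = q ^+ h.+1 * qbin q n h.+1 + qbin q n h.
Proof. by []. Qed.

(** The second q-Pascal rule; the factor q^h on both sides replaces the exponent n - h, which would
    be truncated for n < h. *)
Lemma qbin_pascal_right (R : comNzRingType) (q : R) (n h : nat) :
  q ^+ h * qbin q n.+1 h.+1 = q ^+ h * qbin q n h.+1 + q ^+ n * qbin q n h.
Proof.
elim: n h => [|n IH] [|h].
- by rewrite qbinS qbinn0 qbin0S; ring.
- by rewrite qbinS !qbin0S; ring.
- have := IH 0%N; rewrite !expr0 !mul1r qbinn0 => IH0.
  by rewrite !qbinS !qbinn0 in IH0 *; rewrite {1}IH0 !exprS; ring.
have := IH h; have := IH h.+1; rewrite !qbinS => IH1 IH0.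
transitivity (q ^+ h.+2 * (q ^+ h.+1 * (q ^+ h.+2 * qbin q n h.+2 + qbin q n h.+1))
  + q * (q ^+ h * (q ^+ h.+1 * qbin q n h.+1 + qbin q n h))).
  by rewrite !exprS; ring.
by rewrite [in LHS]IH1 IH0 !exprS; ring.
Qed.

(** The q-hockey-stick identity: the second Pascal rule makes the sum telescope. *)
Lemma sum_qbin (R : comNzRingType) (q : R) (n h : nat) :
  \sum_(i < n) q ^+ i * qbin q i h = q ^+ h * qbin q n h.+1.
Proof.
elim: n => [|n IH]; first by rewrite big_ord0 qbin0S mulr0.
by rewrite big_ord_recr /= IH qbin_pascal_right.
Qed.

Definition grow321 (R : comNzRingType) (t q : R) (f : nat -> R) (e : nat) : R :=
  t * f e.+1 + \sum_(i < e.+1) q ^+ i.+1 * f i.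

Lemma grow321_qbin0 (R : comNzRingType) (t q : R) (e : nat) :
  grow321 t q (fun e => qbin q e 0) e =
  q ^+ 2 * qbin q e 1 + (t + q) * qbin q e 0.
Proof.
rewrite /grow321 !qbinn0.
under eq_bigr do rewrite exprS -mulrA.
by rewrite -mulr_sumr sum_qbin qbinS qbinn0; ring.
Qed.

(** Pascal's rule turns the [t] term into levels h and h + 1; [sum_qbin] and Pascal's rule turn the
    sum into levels h + 1 and h + 2. *)
Lemma grow321_qbinS (R : comNzRingType) (t q : R) (h e : nat) :
  grow321 t q (fun e => qbin q e h.+1) e =
  q ^+ (2 * h.+2) * qbin q e h.+2 + (t + q) * q ^+ h.+1 * qbin q e h.+1
  + t * qbin q e h.
Proof.
rewrite /grow321 qbinS.
under eq_bigr do rewrite exprS -mulrA.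
rewrite -mulr_sumr sum_qbin (qbinS q e h.+1) mul2n -addnn exprD !exprS; ring.
Qed.

Lemma iter_grow321_lin (R : comNzRingType) (t q a b c : R) (m : nat)
    (f f1 f2 f3 : nat -> R) :
  (forall e, f e = a * f1 e + b * f2 e + c * f3 e) ->
  forall e, iter m (grow321 t q) f e =
    a * iter m (grow321 t q) f1 e + b * iter m (grow321 t q) f2 e
    + c * iter m (grow321 t q) f3 e.
Proof.
move=> fE; elim: m => //= m IH e.
rewrite /grow321 -/(grow321 t q) !IH.
rewrite (eq_bigr (fun i : 'I_e.+1 =>
   a * (q ^+ i.+1 * iter m (grow321 t q) f1 i)
   + b * (q ^+ i.+1 * iter m (grow321 t q) f2 i)
   + c * (q ^+ i.+1 * iter m (grow321 t q) f3 i))) => [|i _]; last first.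
  by rewrite IH; ring.
by rewrite !big_split /= -!mulr_sumr; ring.
Qed.

(** * Three-term recurrence of the second tree *)

(* Weighted counts of the m-step extensions of a word with d letters above its
   largest ascent bottom, ending with a descent, resp. an ascent. A final ascent
   is paid for only at the next step: an ascent-descent pair has weight a, any
   other ascent has weight b. *)
Fixpoint desc_gf (R : comNzRingType) (a b q : R) (m d : nat) : R :=
  if m is m'.+1 then \sum_(c < d) q ^+ c * asc_gf a b q m' c.+1 else 1
with asc_gf (R : comNzRingType) (a b q : R) (m d : nat) : R :=
  if m is m'.+1 then b * (\sum_(c < d) q ^+ c * asc_gf a b q m' c.+1)
                     + a * q ^+ d * desc_gf a b q m' d.+1
  else b.

Lemma desc_gfS (R : comNzRingType) (a b q : R) (m d : nat) :
  desc_gf a b q m.+1 d.+1 =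
  desc_gf a b q m.+1 d + q ^+ d * asc_gf a b q m d.+1.
Proof. by rewrite /= big_ord_recr. Qed.

Lemma asc_gfS (R : comNzRingType) (a b q : R) (m d : nat) :
  asc_gf a b q m.+1 d =
  b * desc_gf a b q m.+1 d + a * q ^+ d * desc_gf a b q m d.+1.
Proof. by []. Qed.

Lemma desc_gfS0 (R : comNzRingType) (a b q : R) (m : nat) :
  desc_gf a b q m.+1 0 = 0.
Proof. by rewrite /= big_ord0. Qed.

(* Weighted count of the n-step Motzkin paths from height h to height 0. *)
Definition motz (R : comNzRingType) (a b q : R) (n h : nat) : R :=
  if (h <= n)%N then desc_gf a b q (n - h) h.+1 else 0.

(** In the sum for [desc_gf] the terms c < h form the step down; the term c = h splits, by the
    recursion of [asc_gf], into the level step and the step up. *)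
Lemma motzS (R : comNzRingType) (a b q : R) (n h : nat) :
  motz a b q n.+1 h =
  (if h is h'.+1 then motz a b q n h' else 0)
  + q ^+ h * b * motz a b q n h + a * q ^+ (2 * h).+1 * motz a b q n h.+1.
Proof.
rewrite /motz; have [lt_nh|le_hn] := ltnP n h.
  (* Both sides vanish unless h = n + 1, where the only path steps down throughout. *)
  case: h lt_nh => // h; rewrite ltnS => le_nh.
  have -> : (h.+1 < n)%N = false by lia.
  rewrite !mulr0 !addr0 !ltnS; case: leqP => // le_hn.
  by rewrite subSS; have -> : (n - h = 0)%N by lia.
rewrite leqW // subSn // desc_gfS.
have -> : (if h is h'.+1 then
    if (h' <= n)%N then desc_gf a b q (n - h') h'.+1 else 0 else 0)
   = desc_gf a b q (n - h).+1 h.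
  case: h le_hn => [|h] le_hn; first by rewrite desc_gfS0.
  by rewrite ltnW //; congr desc_gf; lia.
case: ltnP => [lt_hn|ge_hn].
  have -> : (n - h = (n - h.+1).+1)%N by lia.
  by rewrite asc_gfS mul2n -addnn !exprS exprD; ring.
(* At h = n a step up leaves no time to return to 0, and [asc_gf] ends with the value b of the level
   step. *)
have -> : (n - h = 0)%N by lia.
by rewrite /=; ring.
Qed.

(** The factor (t/q)^h q^n turns the bands t, (t+q) q^h, q^(2h+2) of the operator into the step
    weights 1, (1+t/q) q^h, (t/q) q^(2h+1) of [motzS]. *)
Lemma iter_grow321_motz (R : fieldType) (t q : R) (n h : nat) : q != 0 ->
  iter n (grow321 t q) (fun e => qbin q e h) 0 =
  (t / q) ^+ h * q ^+ n * motz (t / q) (1 + t / q) q n h.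
Proof.
move=> q0; elim: n h => [|n IH] h.
  case: h => [|h]; last by rewrite /motz /= mulr0.
  by rewrite /motz /= !mulr1.
(* [iterSr] applies the operator first to the q-binomial itself, where it is tridiagonal. *)
rewrite iterSr motzS; case: h => [|h].
  rewrite (@iter_grow321_lin _ t q (q ^+ 2) (t + q) 0 _ _
    (fun e => qbin q e 1) (fun e => qbin q e 0) (fun e => 0)); last first.
    by move=> e; rewrite grow321_qbin0 mul0r addr0.
  by rewrite !IH !exprS; field.
rewrite (@iter_grow321_lin _ t q (q ^+ (2 * h.+2)) ((t + q) * q ^+ h.+1) t _ _
    (fun e => qbin q e h.+2) (fun e => qbin q e h.+1) (fun e => qbin q e h));
  last by move=> e; rewrite grow321_qbinS.
rewrite !IH !mul2n -!addnn !exprS !exprD !exprS !exprMn !exprVn.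
by field; rewrite q0 expf_neq0.
Qed.

Lemma iter_grow321_desc_gf (R : fieldType) (t q : R) (n : nat) : q != 0 ->
  iter n (grow321 t q) (fun => 1) 0 =
  q ^+ n * desc_gf (t / q) (1 + t / q) q n 1.
Proof.
move=> q0; have := @iter_grow321_motz R t q n 0 q0.
rewrite expr0 mul1r /motz /= subn0 => <-.
(* Linearity with coefficients 1, 0, 0 replaces the constant 1 by the pointwise equal
   [e choose 0]. *)
have := @iter_grow321_lin R t q 1 0 0 n (fun => 1)
  (fun e => qbin q e 0) (fun => 0) (fun => 0).
move=> ->; first by rewrite !mul0r !addr0 mul1r.
by move=> e; rewrite qbinn0 !mul0r !addr0 mulr1.
Qed.

(** * Letters of a permutation and appending a last letter *)

Local Open Scope nat_scope.

Definition letter n (s : 'S_n) (i : nat) : nat := nth 0 (pword s) i.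

Lemma size_pword n (s : 'S_n) : size (pword s) = n.
Proof. by rewrite size_map size_enum_ord. Qed.

Lemma letter_ord n (s : 'S_n) (i : 'I_n) : letter s i = s i.
Proof.
by rewrite /letter (nth_map i) ?size_enum_ord // nth_ord_enum.
Qed.

Lemma letter_lt n (s : 'S_n) i : i < n -> letter s i < n.
Proof. by move=> lt_in; rewrite (letter_ord s (Ordinal lt_in)). Qed.

Lemma letter_inj n (s : 'S_n) i j :
  i < n -> j < n -> letter s i = letter s j -> i = j.
Proof.
move=> lt_in lt_jn; rewrite (letter_ord s (Ordinal lt_in)) (letter_ord s (Ordinal lt_jn)).
by move=> /val_inj /perm_inj [].
Qed.

Lemma letter_onto n (s : 'S_n) x : x < n -> exists2 i, i < n & letter s i = x.
Proof.
move=> lt_xn; exists (s^-1 (Ordinal lt_xn))%g => //.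
by rewrite letter_ord permKV.
Qed.

Lemma sum_letter n (s : 'S_n) (F : nat -> nat) :
  \sum_(i < n) F (letter s i) = \sum_(i < n) F i.
Proof.
rewrite [RHS](reindex_inj (@perm_inj _ s)) /=.
by apply: eq_bigr => i _; rewrite letter_ord.
Qed.

Lemma sum_leq_letter n (s : 'S_n) v : \sum_(i < n) (v <= letter s i) = n - v.
Proof.
rewrite (sum_letter s (fun x => nat_of_bool (v <= x))).
elim: n {s} => [|n IH]; first by rewrite big_ord0.
by rewrite big_ord_recr /= IH; lia.
Qed.

(** Letters at least [v] move up by one to make room for the last letter [v]; the order among the
    earlier letters is kept. *)
Definition append n (s : 'S_n) (v : 'I_n.+1) : 'S_n.+1 := lift_perm ord_max v s.

Lemma append_bij n :
  bijective (fun p : 'S_n * 'I_n.+1 => append p.1 p.2).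
Proof.
apply: inj_card_bij; last by rewrite card_prod !card_Sn card_ord factS mulnC.
move=> [s v] [s' v'] /= E.
have Ev : v = v' by rewrite -(lift_perm_id ord_max v s) -/(append s v) E lift_perm_id.
rewrite -{v'}Ev in E *; congr (_, _); apply/permP => i.
by apply: (@lift_inj _ v); rewrite -!(lift_perm_lift ord_max) -/(append s v) E.
Qed.

Lemma sum_append (R : nmodType) n (P : pred 'S_n.+1) (F : 'S_n.+1 -> R) :
  (\sum_(s | P s) F s = \sum_(s : 'S_n) \sum_(v | P (append s v)) F (append s v))%R.
Proof.
rewrite pair_big_dep /= (reindex (fun p : 'S_n * 'I_n.+1 => append p.1 p.2)) //.
by have [g gK Kg] := append_bij n; exists g => p _; [apply: gK|apply: Kg].
Qed.

Lemma letter_append n (s : 'S_n) v i : i < n -> letter (append s v) i = bump v (letter s i).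
Proof.
move=> lt_in; rewrite (letter_ord s (Ordinal lt_in)).
have := letter_ord (append s v) (lift ord_max (Ordinal lt_in)).
by rewrite lift_max lift_perm_lift.
Qed.

Lemma letter_append_last n (s : 'S_n) v : letter (append s v) n = v.
Proof. by rewrite (letter_ord _ (@ord_max n)) lift_perm_id. Qed.

(** * Patterns of length three *)

Lemma contains3P n (s : 'S_n) x y z :
  reflect (exists i j k, [/\ i < j, j < k, k < n &
             order_iso [:: letter s i; letter s j; letter s k] [:: x; y; z]])
          (contains s [:: x; y; z]).
Proof.
have ltT : transitive (relpre (val : 'I_n -> nat) ltn) by move=> ? ? ?; apply: ltn_trans.
have enumS : sorted (relpre (val : 'I_n -> nat) ltn) (enum 'I_n).
  by rewrite -sorted_map val_enum_ord iota_ltn_sorted.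
apply: (iffP existsP) => [[m]|[i [j [k [lt_ij lt_jk lt_kn iso]]]]].
  rewrite /pword -map_mask => iso.
  have /eqP := proj1 (andP iso); rewrite size_map /=.
  have := sorted_mask ltT m enumS.
  case: (mask m _) iso => [|i [|j [|k []]]] //= iso /and3P[lt_ij lt_jk _] _.
  by exists i, j, k; split; rewrite ?letter_ord.
have lt_jn := ltn_trans lt_jk lt_kn; have lt_in := ltn_trans lt_ij lt_jn.
pose io := Ordinal lt_in; pose jo := Ordinal lt_jn; pose ko := Ordinal lt_kn.
(* The mask selects these three positions; the masked enumeration and the triple are strictly
   increasing with the same elements, hence equal. *)
pose m := [tuple of [seq x \in [:: io; jo; ko] | x <- ord_tuple n]].
exists m; rewrite /pword -map_mask /=.
suff -> : mask m (enum 'I_n) = [:: io; jo; ko].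
  by rewrite /= -!letter_ord.
rewrite /m /= -filter_mask.
have irr : irreflexive (relpre (val : 'I_n -> nat) ltn) by move=> ? /=; rewrite ltnn.
apply: (irr_sorted_eq ltT irr).
- exact: sorted_filter.
- by rewrite /= lt_ij lt_jk.
by move=> u; rewrite mem_filter mem_enum andbT.
Qed.

Lemma order_iso321 a b c :
  order_iso [:: a; b; c] [:: 3; 2; 1] = (c < b) && (b < a).
Proof.
rewrite /order_iso /=; apply/forallP/andP => [H|[lt_cb lt_ba]].
  have /forallP/(_ (Ordinal (isT : 1 < 3)))/eqP := H (Ordinal (isT : 2 < 3)).
  have /forallP/(_ (Ordinal (isT : 0 < 3)))/eqP := H (Ordinal (isT : 1 < 3)).
  by move=> /= -> ->.
by move=> [[|[|[|[]]]] // ?]; apply/forallP => [[[|[|[|[]]]] // ?]]; rewrite /=; lia.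
Qed.

Lemma order_iso231 a b c :
  order_iso [:: a; b; c] [:: 2; 3; 1] = (c < a) && (a < b).
Proof.
rewrite /order_iso /=; apply/forallP/andP => [H|[lt_cb lt_ba]].
  have /forallP/(_ (Ordinal (isT : 0 < 3)))/eqP := H (Ordinal (isT : 2 < 3)).
  have /forallP/(_ (Ordinal (isT : 1 < 3)))/eqP := H (Ordinal (isT : 0 < 3)).
  by move=> /= -> ->.
by move=> [[|[|[|[]]]] // ?]; apply/forallP => [[[|[|[|[]]]] // ?]]; rewrite /=; lia.
Qed.

Lemma avoids321P n (s : 'S_n) :
  reflect (forall i j k, i < j -> j < k -> k < n -> letter s k < letter s j ->
             letter s i <= letter s j)
          (avoids s [:: 3; 2; 1]).
Proof.
apply: (iffP negP) => [H i j k lt_ij lt_jk lt_kn lt_kj | H /contains3P].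
  rewrite leqNgt; apply/negP => lt_ji; apply: H; apply/contains3P.
  by exists i, j, k; rewrite order_iso321 lt_kj lt_ji.
move=> [i [j [k [lt_ij lt_jk lt_kn]]]]; rewrite order_iso321 => /andP[lt_kj].
by rewrite ltnNge (H i j k).
Qed.

Lemma avoids231P n (s : 'S_n) :
  reflect (forall i j k, i < j -> j < k -> k < n -> letter s i < letter s j ->
             letter s i <= letter s k)
          (avoids s [:: 2; 3; 1]).
Proof.
apply: (iffP negP) => [H i j k lt_ij lt_jk lt_kn lt_kj | H /contains3P].
  rewrite leqNgt; apply/negP => lt_ji; apply: H; apply/contains3P.
  by exists i, j, k; rewrite order_iso231 lt_kj lt_ji.
move=> [i [j [k [lt_ij lt_jk lt_kn]]]]; rewrite order_iso231 => /andP[lt_kj].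
by move/(H i j k lt_ij lt_jk lt_kn); rewrite leqNgt lt_kj.
Qed.

(** * The statistics in terms of letters *)

Lemma card_set_pair n (P : nat -> nat -> bool) :
  #|[set p : 'I_n * 'I_n | P p.1 p.2]| = \sum_(i < n) \sum_(j < n) P i j.
Proof.
rewrite -sum1dep_card pair_big /= big_mkcond /=.
by apply: eq_bigr => p _; case: (P _ _).
Qed.

Lemma wexE n (s : 'S_n) : wex s = \sum_(i < n) (i <= letter s i).
Proof.
rewrite /wex -sum1dep_card big_mkcond /=.
by apply: eq_bigr => i _; rewrite letter_ord; case: leqP.
Qed.

Lemma invstE n (s : 'S_n) :
  invst s = \sum_(i < n) \sum_(j < n) ((i < j) && (letter s j < letter s i)).
Proof.
rewrite -(card_set_pair n (fun i j => (i < j) && (letter s j < letter s i))).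
by congr (#|pred_of_set _|); apply/setP => p; rewrite !inE !letter_ord.
Qed.

Lemma st132E n (s : 'S_n) :
  st132 s = \sum_(i < n) \sum_(j < n)
    ((i.+1 < j) && (letter s i < letter s j < letter s i.+1)).
Proof.
by rewrite -(card_set_pair n
     (fun i j => (i.+1 < j) && (letter s i < letter s j < letter s i.+1))).
Qed.

Lemma desE n (s : 'S_n) : des s = \sum_(i < n.-1) (letter s i.+1 < letter s i).
Proof.
rewrite /des /= -sum1_count big_mkcond /= -[X in iota _ X]subn0 big_mkord.
by apply: eq_bigr => i _; rewrite /letter; case: (_ < _).
Qed.

(** The left boundary makes an initial descent a double one, hence [0 < i]; the right boundary keeps
    the last letter from being a double descent. *)
Lemma ddstar_eq0P n (s : 'S_n) :
  reflect (forall i, i.+1 < n -> letter s i.+1 < letter s i ->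
             0 < i /\ letter s i.-1 < letter s i)
          (ddstar s == 0).
Proof.
rewrite /ddstar; set e := n.+1 :: _.
have e0 : nth 0 e 0 = n.+1 by [].
have eS i : i < n -> nth 0 e i.+1 = (letter s i).+1.
  move=> lt_in; rewrite /= nth_rcons size_map size_pword lt_in.
  by rewrite (nth_map 0) ?size_pword.
have eN : nth 0 e n.+1 = n.+1.
  by rewrite /= nth_rcons size_map size_pword ltnn eqxx.
clearbody e; rewrite -leqn0 leqNgt -has_count.
apply: (iffP hasPn) => [H i lt_iSn lt_d|H i].
  have lt_in : i < n by apply: ltnW.
  have := H i; rewrite mem_iota /= lt_in => /(_ isT).
  rewrite !eS // ltnS lt_d andbT -leqNgt.
  case: i lt_iSn lt_d lt_in => [|i] lt_iSn lt_d lt_in.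
    by rewrite e0 ltnNge letter_lt.
  rewrite (eS i (ltnW lt_in)) ltnS /= => le_i; split=> //.
  rewrite ltn_neqAle le_i andbT; apply/eqP => /letter_inj E.
  by have := E (ltnW lt_in) lt_in; lia.
rewrite mem_iota /= => lt_in; rewrite (eS i) //.
have [lt_iSn|le_niS] := ltnP i.+1 n; last first.
  have -> : i.+2 = n.+1 by lia.
  by rewrite eN; have := letter_lt s lt_in; lia.
rewrite eS //; apply/negP => /andP[lt_p]; rewrite ltnS => /(H _ lt_iSn)[lt0i].
case: i lt0i lt_in lt_iSn lt_p => // i _ lt_in lt_iSn.
by rewrite eS /=; lia.
Qed.

Lemma append_onto n (s : 'S_n.+1) : exists s0 v, s = append s0 v.
Proof.
by have [g _ Kg] := append_bij n; exists (g s).1, (g s).2; rewrite Kg.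
Qed.

(** Passes from the appended letter v to the number n - v of letters exceeding it. *)
Lemma sum_rev_tail (R : nmodType) (n k : nat) (g : nat -> R) : k <= n ->
  (\sum_(v < n.+1 | (k <= v)%N) g (n - v)%N = \sum_(i < (n - k).+1) g i)%R.
Proof.
move=> le_kn; rewrite (reindex_inj rev_ord_inj) /=.
rewrite (big_ord_widen n.+1 g) ?ltnS ?leq_subr //.
by apply: eq_big => [i|i _]; [|congr g]; have := ltn_ord i; lia.
Qed.

(** * The tree of 321-avoiding permutations *)

(** The successor of the largest inversion bottom, 0 without inversions: the least letter whose
    appending creates no 321. *)
Definition top321 n (s : 'S_n) : nat :=
  \max_(p : 'I_n * 'I_n | (p.1 < p.2) && (letter s p.2 < letter s p.1)) (letter s p.2).+1.

Lemma top321_leP n (s : 'S_n) m :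
  reflect (forall i j, i < j -> j < n -> letter s j < letter s i -> letter s j < m)
          (top321 s <= m).
Proof.
apply: (iffP (bigmax_leqP _ _ _)) => [H i j lt_ij lt_jn lt_v|H [i j] /= /andP[]].
  by apply: (H (Ordinal (ltn_trans lt_ij lt_jn), Ordinal lt_jn)); rewrite /= lt_ij.
by move=> lt_ij; apply: H.
Qed.

Lemma ltn_top321 n (s : 'S_n) i j :
  i < j -> j < n -> letter s j < letter s i -> letter s j < top321 s.
Proof. by move=> *; apply: (elimT (top321_leP s _) (leqnn _) i j). Qed.

Lemma top321_leq n (s : 'S_n.+1) : top321 s <= n.
Proof.
apply/top321_leP => i j lt_ij lt_jn lt_v.
by have := letter_lt s (ltn_trans lt_ij lt_jn); lia.
Qed.

Lemma avoids321_append n (s : 'S_n) v :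
  avoids (append s v) [:: 3; 2; 1] = avoids s [:: 3; 2; 1] && (top321 s <= v).
Proof.
apply/avoids321P/andP => [H|[/avoids321P Hs /top321_leP Ht] i j k lt_ij lt_jk].
  split.
    apply/avoids321P => i j k lt_ij lt_jk lt_kn.
    have := H i j k lt_ij lt_jk (ltnW lt_kn).
    by rewrite !letter_append /bump; lia.
  apply/top321_leP => i j lt_ij lt_jn.
  have := H i j n lt_ij lt_jn (ltnSn n).
  by rewrite letter_append_last !letter_append /bump; lia.
rewrite ltnS leq_eqVlt => /predU1P[E|lt_kn].
  rewrite E letter_append_last in lt_jk *.
  by have := Ht i j lt_ij lt_jk; rewrite !letter_append /bump; lia.
have := Hs i j k lt_ij lt_jk lt_kn.
by rewrite !letter_append /bump; lia.
Qed.

Lemma top321_append n (s : 'S_n) (v : 'I_n.+1) : top321 s <= v ->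
  top321 (append s v) = if v == n :> nat then top321 s else v.+1.
Proof.
move=> le_tv; apply/eqP; rewrite eqn_leq; apply/andP; split.
  apply/top321_leP => i j lt_ij; rewrite ltnS leq_eqVlt => /predU1P[E|lt_jn].
    rewrite {j}E letter_append_last in lt_ij *.
    have := letter_lt s lt_ij; have := ltn_ord v.
    by rewrite letter_append // /bump; case: eqP; lia.
  have := @ltn_top321 _ s i j lt_ij lt_jn.
  rewrite !letter_append // ?(ltn_trans lt_ij) // /bump.
  by case: eqP; lia.
case: eqP => [Ev|nEv].
  apply/top321_leP => i j lt_ij lt_jn lt_v.
  have := @ltn_top321 _ (append s v) i j lt_ij (ltnW lt_jn).
  have := letter_lt s (ltn_trans lt_ij lt_jn).
  by rewrite !letter_append /bump; lia.
have lt_vn : v < n by have := ltn_ord v; lia.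
(* The old letter [v], raised to v + 1, precedes the new [v] and makes it an inversion bottom. *)
have [i lt_in Ei] := letter_onto s lt_vn.
have := @ltn_top321 _ (append s v) i n lt_in (ltnSn n).
by rewrite letter_append_last letter_append // /bump; lia.
Qed.

(** Pigeonhole: otherwise i distinct letters would all lie below [letter s i], which is less than
    i. *)
Lemma exists_larger_before n (s : 'S_n) i :
  i < n -> letter s i < i -> exists2 j, j < i & letter s i < letter s j.
Proof.
move=> lt_in lt_si.
have [/hasP[j]|/hasPn H] := boolP (has (fun j => letter s i < letter s j) (iota 0 i)).
  by rewrite mem_iota => lt_ji; exists j.
have U : uniq [seq letter s j | j <- iota 0 i].
  rewrite map_inj_in_uniq ?iota_uniq // => j k; rewrite !mem_iota => lt_j lt_k.
  by apply: letter_inj; lia.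
have /(uniq_leq_size U) : {subset [seq letter s j | j <- iota 0 i] <= iota 0 (letter s i)}.
  move=> _ /mapP[j j_in ->]; have := H j j_in.
  move: j_in; rewrite !mem_iota => /= lt_ji le_j.
  have : letter s j <> letter s i by move/letter_inj; lia.
  by lia.
by rewrite size_map !size_iota; lia.
Qed.

(** Raising letters preserves weak excedances. A letter below its position is an inversion bottom,
    hence less than [v] and not raised. *)
Lemma wex_append n (s : 'S_n) (v : 'I_n.+1) : top321 s <= v ->
  wex (append s v) = wex s + (v == n :> nat).
Proof.
move=> le_tv; rewrite !wexE big_ord_recr /= letter_append_last.
congr (_ + _); last by have := ltn_ord v; lia.
apply: eq_bigr => i _; rewrite letter_append // /bump.
have [//|lt_i] := leqP i (letter s i); first by lia.
have [j lt_ji lt_v] := exists_larger_before (ltn_ord i) lt_i.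
by have := ltn_top321 lt_ji (ltn_ord i) lt_v; lia.
Qed.

Lemma invst_append n (s : 'S_n) v : invst (append s v) = invst s + (n - v).
Proof.
rewrite !invstE big_ord_recr /= [X in _ + X]big1 ?addn0; last first.
  by move=> j _; have := ltn_ord j; lia.
rewrite -(sum_leq_letter s v) -big_split; apply: eq_bigr => i _ /=.
rewrite big_ord_recr /= letter_append_last ltn_ord letter_append //; congr (_ + _).
  by apply: eq_bigr => j _; rewrite letter_append // /bump; lia.
by rewrite /bump; lia.
Qed.

Local Open Scope ring_scope.

Lemma sum321_append (R : comNzRingType) (t q : R) (f : nat -> R) n :
  \sum_(s : 'S_n.+2 | avoids s [:: 3; 2; 1]%N)
     t ^+ wex s * q ^+ invst s * f (n.+1 - top321 s)%N =
  \sum_(s : 'S_n.+1 | avoids s [:: 3; 2; 1]%N)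
     t ^+ wex s * q ^+ invst s * grow321 t q f (n - top321 s).
Proof.
rewrite sum_append [RHS]big_mkcond /=; apply: eq_bigr => s _.
under eq_bigl do rewrite avoids321_append.
case: avoids => /=; last by rewrite big_pred0.
have le_tn := top321_leq s.
(* [i] counts the letters exceeding the new one; [i = 0] is the new maximum, which adds a weak
   excedance and keeps [top321]. *)
pose g i : R := (if i is i'.+1 then q ^+ i * f i' else t * f (n - top321 s).+1).
rewrite (eq_bigr (fun v : 'I_n.+2 =>
   t ^+ wex s * q ^+ invst s * g (n.+1 - v)%N)) => [|v le_tv].
  rewrite -mulr_sumr (sum_rev_tail g) ?leqW // subSn // big_ord_recl /=.
  by congr (_ * (_ + _)).
rewrite wex_append // invst_append top321_append //.
have le_vn : (v <= n.+1)%N by rewrite -ltnS.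
case: eqP => [->|nEv]; first by rewrite subnn subSn //= addn0 addn1 exprS; ring.
have lt_vn : (v <= n)%N by lia.
by rewrite addn0 subSS subSn //= exprD mulrA -subSn //; ring.
Qed.

(** The leading factor [t] is the weak excedance of the one-letter word, the root with label 0. *)
Lemma sum321 (R : comNzRingType) (t q : R) (f : nat -> R) n :
  \sum_(s : 'S_n.+1 | avoids s [:: 3; 2; 1]%N)
     t ^+ wex s * q ^+ invst s * f (n - top321 s)%N =
  t * iter n (grow321 t q) f 0.
Proof.
elim: n f => [|n IH] f; last by rewrite sum321_append IH iterSr.
rewrite (big_pred1 1%g) => [|s]; last first.
  have -> : s = 1%g by apply/permP => i; rewrite !ord1.
  by rewrite /= eqxx; apply/avoids321P; lia.
rewrite sub0n wexE invstE !big_ord1 ltnn /= expr1.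
by have := letter_lt (1%g : 'S_1) (ltnSn 0); case: letter => //= _; rewrite mulr1.
Qed.

(** * The tree of 231-avoiding permutations without double descents *)

Local Open Scope nat_scope.

(** Ascents here are pairs of positions, adjacent or not; the value is 0 if there are none. *)
Definition top231 n (s : 'S_n) : nat :=
  \max_(p : 'I_n * 'I_n | (p.1 < p.2) && (letter s p.1 < letter s p.2))
     (letter s p.1).+1.

Lemma top231_leP n (s : 'S_n) m :
  reflect (forall i j, i < j -> j < n -> letter s i < letter s j -> letter s i < m)
          (top231 s <= m).
Proof.
apply: (iffP (bigmax_leqP _ _ _)) => [H i j lt_ij lt_jn lt_v|H [i j] /= /andP[]].
  by apply: (H (Ordinal (ltn_trans lt_ij lt_jn), Ordinal lt_jn)); rewrite /= lt_ij.
by move=> lt_ij; apply: H.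
Qed.

Lemma ltn_top231 n (s : 'S_n) i j :
  i < j -> j < n -> letter s i < letter s j -> letter s i < top231 s.
Proof. by move=> *; apply: (elimT (top231_leP s _) (leqnn _) i j). Qed.

Lemma avoids231_append n (s : 'S_n) v :
  avoids (append s v) [:: 2; 3; 1] = avoids s [:: 2; 3; 1] && (top231 s <= v).
Proof.
apply/avoids231P/andP => [H|[/avoids231P Hs /top231_leP Ht] i j k lt_ij lt_jk].
  split.
    apply/avoids231P => i j k lt_ij lt_jk lt_kn.
    have := H i j k lt_ij lt_jk (ltnW lt_kn).
    by rewrite !letter_append /bump; lia.
  apply/top231_leP => i j lt_ij lt_jn.
  have := H i j n lt_ij lt_jn (ltnSn n).
  by rewrite letter_append_last !letter_append /bump; lia.
rewrite ltnS leq_eqVlt => /predU1P[E|lt_kn].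
  rewrite E letter_append_last in lt_jk *.
  by have := Ht i j lt_ij lt_jk; rewrite !letter_append /bump; lia.
have := Hs i j k lt_ij lt_jk lt_kn.
by rewrite !letter_append /bump; lia.
Qed.

Lemma top231_append n (s : 'S_n) (v : 'I_n.+1) : top231 s <= v ->
  top231 (append s v) = v.
Proof.
move=> le_tv; apply/eqP; rewrite eqn_leq; apply/andP; split.
  apply/top231_leP => i j lt_ij; rewrite ltnS leq_eqVlt => /predU1P[E|lt_jn].
    by rewrite {j}E letter_append_last in lt_ij *.
  have := @ltn_top231 _ s i j lt_ij lt_jn.
  by rewrite !letter_append /bump; lia.
case Ev: (v : nat) => [//|x]; have lt_xn : x < n by have := ltn_ord v; lia.
have [i lt_in Ei] := letter_onto s lt_xn.
have := @ltn_top231 _ (append s v) i n lt_in (ltnSn n).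
by rewrite letter_append_last letter_append // /bump; lia.
Qed.

(** An ascent bottom above the last letter would give a 231; conversely, the letter just below the
    last one precedes it and is an ascent bottom. *)
Lemma letter_last231 n (s : 'S_n.+1) :
  avoids s [:: 2; 3; 1] -> letter s n = top231 s.
Proof.
move=> /avoids231P av; apply/eqP; rewrite eqn_leq; apply/andP; split; last first.
  apply/top231_leP => i j lt_ij lt_jn lt_v.
  have [E|nE] := eqVneq j n; first by rewrite E in lt_v.
  have lt_jn' : j < n by lia.
  have := av i j n lt_ij lt_jn' (ltnSn n) lt_v.
  rewrite leq_eqVlt => /predU1P[/letter_inj|//]; lia.
case El: (letter s n) => [//|x].
have lt_xn : x < n.+1 by have := letter_lt s (ltnSn n); lia.
have [i lt_in Ei] := letter_onto s lt_xn.
have ne_in : i <> n by move=> E; rewrite E El in Ei; lia.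
have lt_in' : i < n by lia.
by have := @ltn_top231 _ s i n lt_in' (ltnSn n); lia.
Qed.

(* The one-letter word counts as ending with a descent, because of the
   convention [pi(0) = n+1]. *)
Definition lastdesc n (s : 'S_n.+1) : bool :=
  (n == 0) || (letter s n < letter s n.-1).

(** The comparison is weak because an old last letter equal to [v] is raised above it. *)
Lemma lastdesc_append n (s : 'S_n.+1) v :
  lastdesc (append s v) = (v <= letter s n).
Proof. by rewrite /lastdesc /= letter_append_last letter_append // /bump; lia. Qed.

Lemma des_append n (s : 'S_n.+1) v :
  des (append s v) = des s + (v <= letter s n).
Proof.
rewrite !desE /= big_ord_recr /= letter_append_last letter_append //.
congr (_ + _); last by rewrite /bump; lia.
apply: eq_bigr => i _; have lt_in := ltn_ord i.
by rewrite !letter_append /bump; lia.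
Qed.

Lemma ddstar_append n (s : 'S_n.+1) v :
  (ddstar (append s v) == 0) =
  (ddstar s == 0) && ~~ (lastdesc s && (v <= letter s n)).
Proof.
apply/ddstar_eq0P/andP => [H|[/ddstar_eq0P Hs Hl] i].
  split.
    apply/ddstar_eq0P => i lt_in.
    have := H i (ltnW lt_in); rewrite !letter_append /bump; lia.
  rewrite /lastdesc; have := H n (ltnSn _).
  rewrite letter_append_last letter_append // => Hn.
  apply/negP => /andP[ld le_v].
  case: Hn => [|lt0n]; first by rewrite /bump; lia.
  by rewrite letter_append /bump; lia.
rewrite ltnS ltnS leq_eqVlt => /predU1P[->|lt_in].
  rewrite letter_append_last letter_append // => lt_v.
  have n0 : 0 < n.
    rewrite lt0n; apply/negP => E; move: Hl lt_v; rewrite /lastdesc E /bump /=.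
    by lia.
  split=> //; move: Hl; rewrite /lastdesc letter_append; last by lia.
  have : letter s n.-1 <> letter s n by move/letter_inj; lia.
  by move: lt_v; rewrite /bump; lia.
have := Hs i lt_in; rewrite !letter_append /bump; lia.
Qed.

Definition good231 n (s : 'S_n) : bool := avoids s [:: 2; 3; 1] && (ddstar s == 0).

(** By [letter_last231] the only admissible letter creating a descent is [top231 s], and it is
    forbidden right after a descent. *)
Lemma good231_append n (s : 'S_n.+1) v :
  good231 (append s v) =
  [&& good231 s, top231 s <= v & ~~ (lastdesc s && (v == top231 s :> nat))].
Proof.
rewrite /good231 avoids231_append ddstar_append.
have [av|//] := boolP (avoids s _); rewrite (letter_last231 av) /=.
case: (ddstar s == 0) => //=; last by rewrite andbF.
by rewrite eqn_leq; case: (leqP (top231 s) v) => //=; rewrite andbT.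
Qed.

(* In a good word each letter exceeding the new last letter [v] is preceded by
   a letter smaller than [v], so it is the 3 of exactly one new 13-2. *)
Lemma st132_append n (s : 'S_n.+1) v : good231 (append s v) ->
  st132 (append s v) = st132 s + (n.+1 - v).
Proof.
move=> good; have [av dd] := andP good.
have le_tv : top231 s <= v by move: av; rewrite avoids231_append => /andP[].
have pred_small j : j < n.+1 -> v <= letter s j -> 0 < j /\ letter s j.-1 < v.
  move=> lt_jn le_vj; have /ddstar_eq0P/(_ j) := dd.
  rewrite (letter_append s v lt_jn).
  (* A letter at least [v] is no ascent bottom, so a smaller letter follows; without double descents
     an ascent must lead to it. *)
  have lt_next : letter (append s v) j.+1 < bump v (letter s j).
    have [lt_jSn|le_nj] := ltnP j.+1 n.+1.
      rewrite letter_append // /bump.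
      have := @ltn_top231 _ s j j.+1 (ltnSn j) lt_jSn.
      have : letter s j.+1 <> letter s j by move/letter_inj; lia.
      by lia.
    have -> : j.+1 = n.+1 by lia.
    by rewrite letter_append_last /bump; lia.
  move=> H; have [lt0j] := H lt_jn lt_next.
  rewrite letter_append; last by lia.
  have lt_j1 : j.-1 < j by lia.
  have := @ltn_top231 _ s j.-1 j lt_j1 lt_jn.
  by rewrite /bump; lia.
rewrite !st132E big_ord_recr /= [X in _ + X]big1 ?addn0; last first.
  by move=> j _; have := ltn_ord j; lia.
have -> : n.+1 - v = \sum_(i < n.+1) [&& i.+1 < n.+1, letter s i < v & v <= letter s i.+1].
  rewrite -(sum_leq_letter s v) big_ord_recl [RHS]big_ord_recr /= ltnn addn0.
  rewrite [X in X + _](_ : _ = 0); last first.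
    by case: leqP => // le_v; have [] := pred_small 0 (ltn0Sn n) le_v.
  rewrite add0n; apply: eq_bigr => i _; rewrite /bump /= add1n ltnS ltn_ord /=.
  case: (leqP v (letter s i.+1)) => [le_v|]; last by rewrite andbF.
  by have [|_ /= ->] := pred_small i.+1 _ le_v; rewrite ?ltnS.
rewrite -big_split; apply: eq_bigr => i _ /=.
rewrite big_ord_recr /= letter_append_last (letter_append _ _ (ltn_ord i)).
congr (_ + _).
  apply: eq_bigr => j _; have lt_jn := ltn_ord j.
  case: ltnP => //= lt_ij.
  by rewrite !letter_append /bump; lia.
case: ltnP => //= lt_in; rewrite letter_append // /bump; lia.
Qed.

(** Each descent is paired with the ascent just before it, a final ascent is unpaired, and there are
    n adjacent pairs of letters. *)
Lemma des_leq_half n (s : 'S_n.+1) :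
  good231 s -> 2 * des s + ~~ lastdesc s <= n.
Proof.
elim: n s => [|n IH] s; first by rewrite desE big_ord0.
have [s0 [v ->]] := append_onto s.
rewrite good231_append => /and3P[good0 le_tv]; have := IH s0 good0.
have /andP[av _] := good0.
rewrite des_append lastdesc_append (letter_last231 av).
by case: lastdesc; case: eqP; lia.
Qed.

(** * Generating function of the second tree *)

Local Open Scope ring_scope.

(** The exponent of [b] counts the ascents that are neither final nor followed by a descent; a final
    one is left to [asc_gf]. *)
Definition weight231 (R : comNzRingType) (a b q : R) (m n : nat) (s : 'S_n.+1) : R :=
  a ^+ des s * b ^+ (n - (2 * des s + ~~ lastdesc s)) * q ^+ st132 s *
  (if lastdesc s then desc_gf a b q m (n.+1 - top231 s)
   else asc_gf a b q m (n.+1 - top231 s)).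

Lemma sum231_append (R : comNzRingType) (a b q : R) m n :
  \sum_(s : 'S_n.+2 | good231 s) weight231 a b q m s =
  \sum_(s : 'S_n.+1 | good231 s) weight231 a b q m.+1 s.
Proof.
rewrite sum_append [RHS]big_mkcond /=; apply: eq_bigr => s _.
under eq_bigl do rewrite good231_append.
have [good|_] := ifPn; last by rewrite big_pred0.
have bound := des_leq_half good; have /andP[av _] := good.
have le_tn : (top231 s <= n)%N.
  by rewrite -letter_last231 // -ltnS letter_lt.
rewrite /= big_mkcondr /=.
set d := (n.+1 - top231 s)%N.
(* [i] counts the letters exceeding the new one, and [i = d] is the descent, which closes an
   ascent-descent pair. *)
pose g i : R :=
  if i == d then
    if lastdesc s then 0 else
    a ^+ (des s).+1 * b ^+ (n - (2 * des s).+1) * q ^+ (st132 s + i)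
      * desc_gf a b q m i.+1
  else a ^+ des s * b ^+ (n - 2 * des s) * q ^+ (st132 s + i) * asc_gf a b q m i.+1.
rewrite (eq_bigr (fun v : 'I_n.+2 => g (n.+1 - v)%N)) => [|v le_tv].
  rewrite (sum_rev_tail g) ?leqW // -/d big_ord_recr /=.
  rewrite {2}/g eqxx (eq_bigr (fun i : 'I_d => a ^+ des s * b ^+ (n - 2 * des s) *
     q ^+ st132 s * (q ^+ i * asc_gf a b q m i.+1))) => [|i _]; last first.
    by rewrite /g ltn_eqF // exprD; ring.
  rewrite -mulr_sumr /weight231 -/d.
  case: (lastdesc s) bound => /= bound; first by rewrite !addn0 addr0.
  have -> : (n - 2 * des s = (n - (2 * des s).+1).+1)%N by lia.
  by rewrite addn1 exprD !exprS; ring.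
have le_vn : (v <= n.+1)%N by rewrite -ltnS.
have Ev : (n.+1 - v == d)%N = (v == top231 s :> nat) by rewrite /d; lia.
have [ok|nok] := ifPn; last first.
  move: nok; rewrite negbK => /andP[ld /eqP E].
  by rewrite /g Ev E eqxx ld.
have good' : good231 (append s v) by rewrite good231_append good le_tv.
rewrite /weight231 st132_append // top231_append // des_append lastdesc_append.
rewrite (letter_last231 av) leq_eqVlt ltnNge le_tv orbF /g Ev (subSn le_vn).
case: eqP ok => [E|nE] ok.
  rewrite andbT in ok; rewrite (negbTE ok) addn1 addn0.
  by congr (_ * _ ^+ _ * _ * _); lia.
by congr (_ ^+ _ * _ ^+ _ * _ * _); lia.
Qed.

(** Each step moves one letter from the pending extension into the word, so n + m is invariant down
    to the one-letter word. *)
Lemma sum231 (R : comNzRingType) (a b q : R) m n :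
  \sum_(s : 'S_n.+1 | good231 s) weight231 a b q m s =
  desc_gf a b q (n + m) 1.
Proof.
elim: n m => [|n IH] m; last by rewrite sum231_append IH addnS addSn.
have top0 : top231 (1%g : 'S_1) = 0%N.
  by apply/eqP; rewrite -leqn0; apply/top231_leP; lia.
rewrite (big_pred1 1%g) => [|s]; last first.
  have -> : s = 1%g by apply/permP => i; rewrite !ord1.
  rewrite /= eqxx; apply/andP; split; first by apply/avoids231P; lia.
  by apply/ddstar_eq0P; lia.
rewrite /weight231 /lastdesc eqxx top0 desE big_ord0 st132E !big_ord1 /=.
by rewrite !expr0 !mul1r add0n.
Qed.

(** * Comparison of the two expansions *)

Theorem theorem4p3 (R : fieldType) (n : nat) (t q : R) :
  (1 <= n)%N -> q != 0 ->
  \sum_(s : 'S_n | avoids s [:: 3; 2; 1]%N) t ^+ wex s * q ^+ invst s =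
  \sum_(1 <= k < ((n.+1)./2).+1)
     (q ^+ (n - k) * \sum_(s : 'S_n | tildeS231 k.-1 s) q ^+ st132 s)
       * t ^+ k * (1 + t / q) ^+ (n.+1 - 2 * k).
Proof.
case: n => // n _ q0.
under eq_bigr do rewrite -[_ * _]mulr1.
rewrite (sum321 t q (fun => 1)) iter_grow321_desc_gf //.
rewrite -[n in desc_gf _ _ _ n]addn0 -sum231 big_add1 /= big_mkord.
have des_lt (s : 'S_n.+1) : good231 s -> (des s < (n./2).+1)%N.
  by move/des_leq_half; lia.
(* The index is now the number of descents, one less than the k of the statement. *)
rewrite (partition_big (fun s : 'S_n.+1 => inord (des s) : 'I_(n./2).+1) xpredT) //=.
rewrite mulrA mulr_sumr; apply: eq_bigr => k _.
rewrite mulr_sumr !(mulr_sumr, mulr_suml).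
have le_kn : (2 * k <= n)%N by have := ltn_ord k; lia.
apply: eq_big => [s|s /andP[good /eqP Ek]].
  rewrite /tildeS231 andbA -/(good231 s); have [good|//] := boolP (good231 s).
  by rewrite /= -val_eqE /= inordK // des_lt.
have {Ek} Ek : des s = k by rewrite -Ek inordK // des_lt.
have := des_leq_half good; rewrite /weight231 Ek => bound.
have -> : (n.+2 - 2 * k.+1 = n - 2 * k)%N by lia.
have -> : (n.+1 - k.+1 = n - k)%N by lia.
(* The part q^k of q^n cancels the denominator of (t/q)^k. *)
have {1}-> : n = ((n - k) + k)%N by lia.
set u := 1 + t / q.
transitivity (t ^+ k.+1 * q ^+ (n - k) * q ^+ st132 s *
  (u ^+ (n - (2 * k + ~~ lastdesc s)) * (if lastdesc s then 1 else u))).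
  rewrite exprD exprMn exprVn exprS.
  by case: lastdesc => /=; field; rewrite expf_neq0.
case: lastdesc bound => /= bound; first by rewrite addn0; ring.
(* A final ascent lacks one factor [u] in the weight, and [asc_gf] at m = 0 supplies it. *)
have -> : (n - 2 * k = (n - (2 * k + 1)).+1)%N by lia.
by rewrite !exprS; ring.
Qed.
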